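(* There exists an absolute constant $c>0$ such that for every integer $d\geq 2$, $$\Gamma_d\ \geq\ c\,\frac{2^{-d}}{d\log d}.$$ More explicitly, for every integer $d\ge 2$, any finite collection $\mathcal{C}$ of cubes in $\mathbb{R}^d$ with sides parallel to the coordinate axes admits a (pairwise) disjoint sub-collection $\mathcal{S}\subseteq\mathcal{C}$ such that $$\Bigl|\bigcup_{Q\in\mathcal{S}}Q\Bigr|\ \geq\ c\,\frac{2^{-d}}{d\log d}\,\Bigl|\bigcup_{Q\in\mathcal{C}}Q\Bigr|.$$ Moreover, the bound continues to hold with $c$ replaced by $e^{-1-\frac{\log\log d}{\log d}+O\left(\frac{1}{\log d}\right)}$; that is, there is an absolute constant $K>0$ such that for every integer $d\geq 2$, $$\Gamma_d\ \geq\ \exp\Bigl(-1-\frac{\log\log d}{\log d}-\frac{K}{\log d}\Bigr)\,\frac{2^{-d}}{d\log d}.$$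
   Context: $|E|$ denotes the Lebesgue measure of a measurable set $E\subseteq\mathbb{R}^d$, and $\log$ is the natural logarithm. A cube with sides parallel to the coordinate axes is a closed cube $\prod_{k=1}^d[a_k,a_k+\ell]$ with side length $\ell>0$. A collection of sets is disjoint if its members are pairwise disjoint. $\Gamma_d$ denotes the largest constant such that every finite collection $\mathcal{C}$ of cubes in $\mathbb{R}^d$ with sides parallel to the coordinate axes (of possibly different side lengths) admits a disjoint sub-collection $\mathcal{S}\subseteq\mathcal{C}$ with $|\bigcup_{Q\in\mathcal{S}}Q|\geq \Gamma_d\,|\bigcup_{Q\in\mathcal{C}}Q|$. *)

(* Defs.v *)
From HB Require Import structures.
From mathcomp Require Import all_boot all_order all_algebra finmap.
From mathcomp Require Import all_classical all_reals all_analysis.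

Set Implicit Arguments.
Unset Strict Implicit.
Unset Printing Implicit Defensive.

Import Order.TTheory GRing.Theory Num.Theory.

Local Open Scope classical_set_scope.
Local Open Scope ring_scope.

(* MathComp-Analysis has this as an instance, but the canonical instance for
   finite (sub-probability) products takes precedence in inference. *)
Lemma sigma_finite_product d1 d2 (T1 : measurableType d1)
    (T2 : measurableType d2) (R : realType)
    (m1 : {sigma_finite_measure set T1 -> \bar R})
    (m2 : {sigma_finite_measure set T2 -> \bar R}) :
  sigma_finite setT (m1 \x m2)%E.
Proof.
have /sigma_finiteP[F [TF ndF Foo]] := sigma_finiteT m1.
have /sigma_finiteP[G [TG ndG Goo]] := sigma_finiteT m2.
exists (fun n => F n `*` G n).
  rewrite -setXTT TF TG predeqE => -[x y]; split; last first.
    by move=> [n _ []/= ? ?]; split; exists n.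
  move=> [/= [n _ Fnx] [k _ Gky]]; exists (maxn n k) => //; split.
  - by move: x Fnx; exact/subsetPset/ndF/leq_maxl.
  - by move: y Gky; exact/subsetPset/ndG/leq_maxr.
move=> k; have [? ?] := Foo k; have [? ?] := Goo k.
split; first exact: measurableX.
by rewrite product_measure1E// lte_mul_pinfty// ge0_fin_numE.
Qed.

Section cons_measure.
Context {d} {T : measurableType d} {R : realType} {n : nat}.
Variables (m1 : {sigma_finite_measure set T -> \bar R})
  (m2 : {sigma_finite_measure set (n.-tuple T) -> \bar R}).

Definition tcons (p : T * n.-tuple T) : n.+1.-tuple T :=
  [tuple of p.1 :: p.2].

Lemma measurable_tcons : measurable_fun setT tcons.
Proof. exact: measurable_cons. Qed.

Definition cons_measure : set (n.+1.-tuple T) -> \bar R :=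
  pushforward (m1 \x m2)%E tcons.

Let cons_measure0 : cons_measure set0 = 0%E.
Proof. by rewrite /cons_measure /pushforward preimage_set0 measure0. Qed.

Let cons_measure_ge0 A : (0 <= cons_measure A)%E.
Proof. by rewrite /cons_measure /pushforward measure_ge0. Qed.

Let cons_measure_sigma_additive : semi_sigma_additive cons_measure.
Proof.
move=> F mF tF mUF; rewrite /cons_measure /pushforward preimage_bigcup.
have mt A : measurable A -> measurable (tcons @^-1` A).
  by move=> mA; rewrite -[X in measurable X]setTI; exact: measurable_tcons.
apply: measure_semi_sigma_additive.
- by move=> i; exact: mt.
- apply/trivIsetP => /= i j _ _ ij; rewrite -preimage_setI.
  by move/trivIsetP : tF => /(_ _ _ _ _ ij) ->//; rewrite preimage_set0.
- by rewrite -preimage_bigcup; exact: mt.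
Qed.

HB.instance Definition _ := isMeasure.Build _ _ _ cons_measure
  cons_measure0 cons_measure_ge0 cons_measure_sigma_additive.

Let cons_measure_sigma_finite : sigma_finite setT cons_measure.
Proof.
have [F FT Ffin] := sigma_finite_product m1 m2.
pose uncons (x : n.+1.-tuple T) := (thead x, [tuple of behead x]).
have tconsK : cancel tcons uncons.
  by move=> [x y]; rewrite /uncons /tcons/= theadE; congr pair; exact: val_inj.
have muncons : measurable_fun setT uncons.
  apply/measurable_fun_pairP; split; last exact: measurable_behead.
  exact: (measurable_tnth ord0).
exists (fun i => uncons @^-1` F i).
  by rewrite -preimage_bigcup -FT preimage_setT.
move=> i; have [mFi Fioo] := Ffin i; split.
  by rewrite -[X in measurable X]setTI; exact: muncons.
rewrite /cons_measure /pushforward -comp_preimage (_ : _ \o _ = id)//.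
exact/funext.
Qed.

HB.instance Definition _ := Measure_isSigmaFinite.Build _ _ _ cons_measure
  cons_measure_sigma_finite.

End cons_measure.

(* R^d with the product of the Borel sigma-algebras of the coordinates *)
Notation euclidean R d := (d.-tuple (measurableTypeR R)).

(* Lebesgue measure on the Borel sets of R^d, as an iterated product measure *)
Fixpoint lebesgue_tuple (R : realType) (d : nat) :
    {sigma_finite_measure set (euclidean R d) -> \bar R} :=
  match d with
  | 0 => \d_[tuple]
  | d'.+1 => cons_measure (@lebesgue_measure R) (lebesgue_tuple R d')
  end.

Definition cube (R : realType) (d : nat) (a : euclidean R d) (l : R) :
    set (euclidean R d) :=
  [set x | forall k : 'I_d, tnth a k <= (tnth x k : R) <= tnth a k + l].

Definition is_cube (R : realType) (d : nat) (Q : set (euclidean R d)) : Prop :=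
  exists (a : euclidean R d) (l : R), 0 < l /\ Q = cube a l.

Definition disjoint_fraction (R : realType) (d : nat) (g : R) : Prop :=
  forall C : set (set (euclidean R d)),
    finite_set C -> (forall Q, C Q -> is_cube Q) ->
    exists S : set (set (euclidean R d)),
      [/\ S `<=` C, trivIset S id &
          (g%:E * lebesgue_tuple R d (\bigcup_(Q in C) Q)
             <= lebesgue_tuple R d (\bigcup_(Q in S) Q))%E].

(* The supremum is attained; see disjoint_fraction_Gamma and le_Gamma below. *)
Definition Gamma (R : realType) (d : nat) : R :=
  sup [set g : R | disjoint_fraction d g].

Lemma measurable_cube (R : realType) (d : nat) (a : euclidean R d) (l : R) :
  measurable (cube a l).
Proof.
rewrite (_ : cube a l = \bigcap_(k in [set: 'I_d])
    ((@tnth d (measurableTypeR R))^~ k @^-1` `[tnth a k, tnth a k + l])).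
  apply: fin_bigcap_measurable => // k _.
  rewrite -[X in measurable X]setTI.
  by apply: measurable_tnth => //; exact: measurable_itv.
apply/seteqP; split => x.
  by move=> xa k _ /=; rewrite in_itv/=; exact: xa.
by move=> xa k; have := xa k Logic.I; rewrite /= in_itv.
Qed.

Lemma lebesgue_tuple_cube (R : realType) (d : nat) (a : euclidean R d) (l : R) :
  0 < l -> lebesgue_tuple R d (cube a l) = (l ^+ d)%:E.
Proof.
move=> l0; elim: d a => [|d IHd] a /=.
  rewrite diracE mem_set ?expr0// => k; by case: k.
rewrite /cons_measure /pushforward.
pose a' : euclidean R d := [tuple of behead a].
rewrite (_ : _ @^-1` _ = `[thead a, thead a + l] `*` cube a' l).
  rewrite product_measure1E; [|exact: measurable_itv|exact: measurable_cube].
  rewrite IHd exprS EFinM; congr (_ * _)%E.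
  apply: etrans; first exact: lebesgue_measure_itv.
  by rewrite /= lte_fin ltrDl l0 -EFinB addrAC subrr add0r.
apply/seteqP; split => -[x y] /=.
  move=> xa; split.
    by have := xa ord0; rewrite in_itv.
  move=> k; have := xa (lift ord0 k).
  by rewrite /tcons/= [in X in X -> _](tuple_eta a) !tnthS.
rewrite in_itv/= => -[xa ya] k.
have [j ->|->] := unliftP ord0 k; last exact: xa.
by rewrite (tuple_eta a) !tnthS; exact: ya.
Qed.

Lemma lebesgue_tuple_cubes (R : realType) (d : nat)
    (C : set (set (euclidean R d))) :
  finite_set C -> (forall Q, C Q -> is_cube Q) ->
  measurable (\bigcup_(Q in C) Q) /\
  lebesgue_tuple R d (\bigcup_(Q in C) Q) \is a fin_num.
Proof.
move=> finC cubeC.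
have mC Q : C Q -> measurable Q.
  by move=> /cubeC[a [l [_ ->]]]; exact: measurable_cube.
have mUC : measurable (\bigcup_(Q in C) Q) by exact: fin_bigcup_measurable.
split => //; rewrite ge0_fin_numE; last exact: measure_ge0.
apply: le_lt_trans (content_sub_fsum (lebesgue_tuple R d) finC mC mUC _) _ => //.
rewrite fsbig_finite//= big_seq_cond.
apply: lte_sum_pinfty => Q; rewrite andbT in_fset_set// inE => /cubeC[a [l [l0 ->]]].
by rewrite lebesgue_tuple_cube// ltry.
Qed.

Lemma disjoint_fraction0 (R : realType) (d : nat) : disjoint_fraction d (0 : R).
Proof.
move=> C finC cubeC; exists set0; split => //.
by rewrite mul0e measure_ge0.
Qed.

Lemma disjoint_fraction_le1 (R : realType) (d : nat) (g : R) :
  disjoint_fraction d g -> g <= 1.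
Proof.
pose a : euclidean R d := [tuple (0 : R) | i < d].
move=> /(_ [set cube a 1])[||S [SC _]].
- exact: finite_set1.
- by move=> _ ->; exists a, 1.
rewrite bigcup_set1 lebesgue_tuple_cube// expr1n mule1 => /le_trans.
move=> /(_ (lebesgue_tuple R d (cube a 1))).
rewrite lebesgue_tuple_cube// expr1n lee_fin; apply.
rewrite -(expr1n R d) -(lebesgue_tuple_cube a)//.
have fS : finite_set S by apply: sub_finite_set SC _.
apply: le_measure; rewrite ?inE.
- apply: fin_bigcup_measurable => // Q /SC ->; exact: measurable_cube.
- exact: measurable_cube.
- by move=> x [Q /SC ->].
Qed.

Lemma has_sup_disjoint_fraction (R : realType) (d : nat) :
  has_sup [set g : R | disjoint_fraction d g].
Proof.
split; first by exists 0; exact: disjoint_fraction0.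
by exists 1 => g; exact: disjoint_fraction_le1.
Qed.

Lemma le_Gamma (R : realType) (d : nat) (g : R) :
  disjoint_fraction d g -> g <= Gamma R d.
Proof. exact/ub_le_sup/(has_sup_disjoint_fraction R d).2. Qed.

Lemma disjoint_fraction_Gamma (R : realType) (d : nat) :
  disjoint_fraction d (Gamma R d).
Proof.
move=> C finC cubeC.
have [mUC fUC] := lebesgue_tuple_cubes finC cubeC.
set mu := lebesgue_tuple R d in fUC *.
pose M := fine (mu (\bigcup_(Q in C) Q)).
have ME : mu (\bigcup_(Q in C) Q) = M%:E by rewrite /M fineK.
have : 0 <= M by exact: fine_ge0.
rewrite le_eqVlt => /predU1P[M0|M0].
  exists set0; split => //.
  by rewrite ME -M0 mule0 measure_ge0.
pose ok S := S `<=` C /\ trivIset S id.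
pose v S := fine (mu (\bigcup_(Q in S) Q)).
have vE S : S `<=` C -> mu (\bigcup_(Q in S) Q) = (v S)%:E.
  move=> SC; rewrite /v fineK//; apply: (lebesgue_tuple_cubes _ _).2.
    exact: sub_finite_set finC.
  by move=> Q /SC; exact: cubeC.
apply: contrapT => noS.
have vlt S : ok S -> v S < Gamma R d * M.
  move=> [SC tS]; rewrite ltNge; apply/negP => h; apply: noS; exists S; split => //.
  by rewrite ME vE// -EFinM lee_fin.
pose s := fpowerset (fset_set C).
pose m := \big[Order.max/Gamma R d * M - 1]_(Y <- s | `[< ok [set` Y] >]) v [set` Y].
have mlt : m < Gamma R d * M.
  apply: bigmax_lt; first by rewrite ltrBlDr ltrDl.
  by move=> Y /asboolP; exact: vlt.
have lem S : ok S -> v S <= m.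
  move=> okS; have fS : finite_set S by apply: sub_finite_set finC; case: okS.
  rewrite -(fset_setK fS); rewrite /m.
  apply: (@Order.TotalTheory.le_bigmax_seq _ _ _ _ _ (fset_set S) _
    (fun Y : {fset _} => v [set` Y])).
    rewrite fpowersetE; apply/fsubsetP => Q.
    by rewrite !in_fset_set// !inE; exact: okS.1.
  by apply/asboolP; rewrite fset_setK.
have e0 : 0 < Gamma R d - m / M by rewrite subr_gt0 ltr_pdivrMr.
have [g gd] := sup_adherent e0 (has_sup_disjoint_fraction R d).
rewrite -/(Gamma R d) opprB addrC subrK ltr_pdivrMr// => mg.
have [S [SC tS]] := gd C finC cubeC.
rewrite -/mu ME vE// -EFinM lee_fin => /(lt_le_trans mg).
by rewrite ltNge lem.
Qed.

(* Main.v *)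
Require Import Defs.
From mathcomp Require Import all_boot all_order all_algebra finmap.
From mathcomp Require Import all_classical all_reals all_analysis.
From HB Require Import structures.
From mathcomp Require Import measurable_realfun lra ring zify.

Import Order.TTheory GRing.Theory Num.Theory.

Local Open Scope classical_set_scope.
Local Open Scope ring_scope.

(** The proof gives Gamma_d >= 2^-d / (2 (e^2 + 1) d), which is stronger by a
    factor of order log d than both claimed bounds; since log d is at least
    log 2, and since any fixed c log d dominates the exponential correction once
    K is large ([correction_le]), both follow.

    For congruent cubes of side 1, the factor 2^-d comes from averaging over the
    translates of a grid of mesh slightly above 2: some translate has about
    2^-d |U| nodes in the union U, and cubes through distinct nodes are
    disjoint.  Here the grid is built one coordinate at a time by Fubini, with
    offsets allowed to differ from slice to slice, so that only translations
    of the line are ever averaged ([measure_le_separated]).  For cubes whose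
    sides agree up to a factor lam, the same argument loses a power lam^(2d)
    ([comparable_disjoint]), which is at most e^2 for lam = 1 + 1/d.

    When any two sides either agree up to the factor lam or differ by a factor
    of at least 2 lam, select greedily from the largest scale down: choose
    disjoint cubes among the largest ones, discard the smaller cubes that meet
    them, and recurse.  A discarded cube is at most half as large as the selected
    cube that it meets, hence lies in the concentric double, so that discarding
    costs only another 2^d times the selected volume, the same order as the loss
    already made within one scale ([greedy_disjoint]).

    Finally, since lam^d >= 2, splitting an arbitrary family according to
    floor (log_lam side) modulo d + 2 gives d + 2 such families
    ([scale_dichotomy]), one of which covers a fraction 1 / (d + 2) of the
    union. *)

(** * Averaging over translations of the line *)

Lemma ge0_integral_translate (R : realType) (c : R)
    (g : R -> \bar R) :
  measurable_fun [set: R] g -> (forall x, 0 <= g x)%E ->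
  (\int[@lebesgue_measure R]_x g (x + c)%R =
   \int[@lebesgue_measure R]_x g x)%E.
Proof.
move=> mg g0.
have mc : measurable_fun [set: measurableTypeR R]
    (fun x : measurableTypeR R => (x + c)%R : measurableTypeR R).
  exact: measurable_funD.
pose phi : {mfun measurableTypeR R >-> measurableTypeR R} :=
  HB.pack (fun x : measurableTypeR R => (x + c)%R : measurableTypeR R)
    (isMeasurableFun.Build _ _ _ _ _ mc).
have mE : forall A, measurable A ->
    lebesgue_measure A = pushforward (@lebesgue_measure R) phi A.
  apply: lebesgue_measure_unique => _ [[a b] _ <-] /=.
  rewrite /pushforward.
  rewrite (_ : _ @^-1` _ = `]a - c, b - c]%classic); last first.
    by apply/seteqP; split => x /=; rewrite !in_itv/= ltrBlDr lerBrDr.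
  rewrite [LHS]lebesgue_measure_itv [RHS]lebesgue_measure_itv/= !lte_fin.
  by rewrite ltrD2r; case: ifPn => // _; rewrite -!EFinB; congr EFin; lra.
rewrite [RHS](@eq_measure_integral _ _ _ _ (pushforward lebesgue_measure phi)); last first.
  by move=> A mA _; exact: mE.
by rewrite ge0_integral_pushforward// preimage_setT.
Qed.

(** Cutting the line into the n intervals of length s from a on and translating
    them all onto the first one turns the integral of g into the integral, over
    an interval of length s, of the sums that are assumed to be at most M. *)
Lemma ge0_integral_le_periodic_sum (R : realType) (g : R -> \bar R) (a s M : R) (n : nat) :
  0 < s -> measurable_fun [set: R] g -> (forall x, 0 <= g x)%E ->
  (forall x, ~~ (a <= x < a + s *+ n) -> g x = 0%E) ->
  (forall t, a <= t < a + s -> (\sum_(k < n) g (t + s *+ k)%R <= M%:E)%E) ->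
  (\int[@lebesgue_measure R]_x g x <= (s * M)%:E)%E.
Proof.
move=> s0 mg g0 gout gle.
pose I (k : nat) : set R := `[a + s *+ k, a + s *+ k.+1[%classic.
pose f k x : \bar R := (g \_ (I k)) x.
have mI k : measurable (I k) by exact: measurable_itv.
have mf k : measurable_fun [set: R] (f k).
  apply/(measurable_restrictT _ (mI k)).
  exact: measurable_funTS.
have f0 k x : (0 <= f k x)%E by rewrite /f patchE; case: ifP.
have gE x : (g x <= \sum_(k < n) f k x)%E.
  have [xI|/gout ->] := boolP (a <= x < a + s *+ n); last exact: sume_ge0.
  suff [k [kn xk]] : exists k, (k < n)%N /\ I k x.
    rewrite (bigD1 (Ordinal kn))//= {1}/f patchE mem_set// leeDl//.
    exact: sume_ge0.
  have ex : exists k, x < a + s *+ k by exists n; case/andP: xI.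
  case: (ex_minnP ex) => -[|k] xk mink.
    by move: xI; rewrite leNgt; move: xk; rewrite mulr0n addr0 => ->.
  exists k; split; first by apply: mink; case/andP: xI.
  rewrite /I/= in_itv/= xk andbT leNgt; apply/negP => /mink.
  by rewrite ltnn.
have fE k x : f k (x + s *+ k)%R = ((fun y => g (y + s *+ k)%R) \_ (I 0)) x.
  rewrite /f !patchE /I; congr (if _ then _ else _).
  apply/idP/idP => /[!inE]/=; rewrite !in_itv/= mulr0n mulr1n mulrS; lra.
have mfs : measurable_fun [set: R] (fun x => \sum_(k < n) f k x)%E.
  exact: emeasurable_sum.
have mft k : measurable_fun [set: R] (fun x => f k (x + s *+ k)).
  by apply: measurableT_comp => //; exact: measurable_funD.
have mfts : measurable_fun [set: R] (fun x => \sum_(k < n) f k (x + s *+ k)%R)%E.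
  by apply: emeasurable_sum => k; exact: mft.
apply: (@le_trans _ _ (\int[lebesgue_measure]_x \sum_(k < n) f k x)%E).
  exact: ge0_le_integral.
rewrite ge0_integral_sum//; last exact: mf.
under eq_bigr => k _ do rewrite -(ge0_integral_translate _ (s *+ k))//.
rewrite -ge0_integral_sum//; last exact: mft.
have -> : ((s * M)%:E = \int[@lebesgue_measure R]_(x in I 0%N) M%:E)%E.
  rewrite integral_cst; last exact: mI.
  rewrite [X in (_ * X)%E](_ : _ = s%:E) -?EFinM 1?mulrC//.
  apply: etrans; first exact: lebesgue_measure_itv.
  by rewrite /= mulr0n mulr1n addr0 lte_fin ltrDl s0 -EFinB addrAC subrr add0r.
rewrite [X in (_ <= X)%E]integral_mkcond.
apply: ge0_le_integral => //.
- by move=> x _; exact: sume_ge0.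
- by apply/(measurable_restrictT _ (mI _)).
move=> x _; under eq_bigr do rewrite fE.
rewrite patchE; under eq_bigr do rewrite patchE.
case: ifPn => [|_]; last by rewrite big1.
rewrite inE /I/= in_itv/= mulr0n mulr1n addr0; exact: gle.
Qed.

(** * Separated points in a set of large measure *)

(** The points are at sup-norm distance at least s; stated with an existential
    over coordinates so that it also makes sense in dimension 0, where no two
    points are separated. *)
Definition separated {R : realType} {d} (s : R) (x y : euclidean R d) : bool :=
  [exists k, s <= `|(tnth x k : R) - tnth y k|].

(** In place of a lattice in R^(d+1), one takes a grid of mesh s on the first
    axis and, above each of its nodes, separated points of the corresponding
    slice: these sets need no relation to one another, since the first
    coordinate already separates different slices.  If a largest separated
    subset of U has m points, then the slices over the nodes of any grid have
    measures summing to at most m s^d, and averaging over the grids bounds the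
    measure of U by m s^(d+1).  Working with a maximum spares finding a grid
    at which the average is attained. *)
Lemma measure_le_separated (R : realType) d (U : set (euclidean R d)) a (l s : R) :
  0 < s -> 0 < l -> measurable U -> U `<=` cube a l ->
  exists P : seq (euclidean R d),
    [/\ [set` P] `<=` U, pairwise (separated s) P &
        (lebesgue_tuple R d U <= (s ^+ d *+ size P)%:E)%E].
Proof.
move=> s0 l0; elim: d U a => [|d IHd] U a mU Ua.
  have [U0|U0] := pselect (U [tuple]).
    exists [:: [tuple]]; split => //.
      by move=> x /=; rewrite inE => /eqP ->.
    by rewrite expr0 /= diracE; case: (_ \in _); rewrite lee_fin ?ler01.
  exists [::]; split => //=.
  by rewrite diracE memNset.
pose V := @tcons _ (measurableTypeR R) d @^-1` U.
have mV : measurable V.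
  by rewrite -[X in measurable X]setTI; exact: measurable_tcons.
pose g (x : R) : \bar R := lebesgue_tuple R d (xsection V x).
have mg : measurable_fun [set: R] g.
  exact: (measurable_fun_xsection (lebesgue_tuple R d) mV).
have UE : lebesgue_tuple R d.+1 U = (\int[@lebesgue_measure R]_x g x)%E by [].
pose a' : euclidean R d := [tuple of behead a].
have slice x : xsection V x `<=` cube a' l.
  move=> y /xsectionP /Ua /= ya k; have := ya (lift ord0 k).
  by rewrite /tcons/= [in X in X -> _](tuple_eta a) !tnthS.
pose n := (Num.truncn (l / s)).+1.
have ln : l < s *+ n.
  by rewrite -mulr_natr mulrC -ltr_pdivrMr// truncnS_gt.
have gout x : ~~ ((thead a : R) <= x < (thead a : R) + s *+ n) -> g x = 0%E.
  move=> xa; rewrite /g (_ : xsection V x = set0) ?measure0//.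
  apply/seteqP; split => // y /xsectionP /Ua /= /(_ ord0) /= xal.
  move/negP: xa; apply.
  by case/andP: xal => [-> xl] /=; apply: (le_lt_trans xl); rewrite ltrD2l.
pose valid (P : seq (euclidean R d.+1)) := [set` P] `<=` U /\ pairwise (separated s) P.
have stack t k : exists P, [/\ valid P,
    forall x, x \in P -> exists2 i, (i < k)%N & thead x = t + s *+ i :> R &
    (\sum_(i < k) g (t + s *+ i)%R <= (s ^+ d *+ size P)%:E)%E].
  elim: k => [|k [P [[PU sP] Pk gP]]].
    by exists [::]; split => //; rewrite big_ord0.
  have [||Q [QV sQ gQ]] := IHd (xsection V (t + s *+ k)) a'.
  - exact: measurable_xsection.
  - exact: slice.
  pose f (y : euclidean R d) : euclidean R d.+1 :=
    tcons ((t + s *+ k : measurableTypeR R), y).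
  exists (P ++ map f Q); split.
  - split.
      move=> x; rewrite /= mem_cat => /orP[/PU//|/mapP[y yQ ->]].
      by have /xsectionP := QV _ yQ.
    rewrite pairwise_cat sP/= pairwise_map; apply/andP; split; last first.
      apply: sub_pairwise sQ => x y /existsP[i xy]; apply/existsP.
      by exists (lift ord0 i); rewrite /f /tcons/= !tnthS.
    apply/allrelP => x y /Pk[i ik xi] /mapP[z _ ->]; apply/existsP; exists ord0.
    rewrite [tnth x _]xi -[tnth _ _]/(t + s *+ k : R).
    rewrite opprD addrACA subrr add0r distrC -mulrnBr 1?ltnW// ger0_norm.
      by rewrite -{1}(mulr1n s) ler_pMn2l// subn_gt0.
    by rewrite mulrn_wge0// ltW.
  - move=> x; rewrite mem_cat => /orP[/Pk[i ik ->]|/mapP[y yQ ->]].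
      by exists i => //; exact: ltnW.
    by exists k.
  - by rewrite big_ord_recr/= size_cat size_map mulrnDr EFinD leeD.
have Ufin : lebesgue_tuple R d.+1 U \is a fin_num.
  rewrite ge0_fin_numE//; apply: (@le_lt_trans _ _ (lebesgue_tuple R d.+1 (cube a l))).
    by apply: le_measure; rewrite ?inE//; exact: measurable_cube.
  by rewrite lebesgue_tuple_cube// ltry.
(* Under the negated conclusion, separated subsets of U have sizes below
   mu U / s^(d+1), so that a largest one exists. *)
apply: contrapT => noP.
pose A := fine (lebesgue_tuple R d.+1 U).
have small P : valid P -> s ^+ d.+1 *+ size P < A.
  move=> [PU sP]; rewrite ltNge; apply/negP => AP; apply: noP; exists P; split => //.
  by rewrite -(fineK Ufin) lee_fin.
pose p m := `[< exists P, valid P /\ size P = m >].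
have exp : exists m, p m by exists 0%N; apply/asboolP; exists [::].
have bp m : p m -> (m <= Num.truncn (A / s ^+ d.+1))%N.
  move=> /asboolP[P [/small + <-]].
  rewrite -mulr_natr mulrC -ltr_pdivlMr ?exprn_gt0// => /ltW.
  rewrite truncn_ge_nat//.
  by apply: divr_ge0; [exact: fine_ge0|exact/exprn_ge0/ltW].
case: (ex_maxnP exp bp) => m /asboolP[P [vP Pm]] maxm.
have := small _ vP; rewrite ltNge => /negP; apply.
rewrite -lee_fin fineK// UE exprS -mulrnAr.
apply: (@ge0_integral_le_periodic_sum _ _ (thead a) _ _ n) => // t _.
have [Q [vQ _ /le_trans]] := stack t n; apply.
rewrite lee_fin ler_pMn2l ?exprn_gt0// Pm; apply: maxm; apply/asboolP.
by exists Q.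
Qed.

(** * Disjoint subfamilies of cubes *)

(** Corners and sides are given by functions of the set, chosen once for the
    whole family, so that subfamilies inherit them. *)
Definition cubes {R : realType} {d} (a : set (euclidean R d) -> euclidean R d)
    (side : set (euclidean R d) -> R) (C : set (set (euclidean R d))) :=
  forall Q, C Q -> 0 < side Q /\ Q = cube (a Q) (side Q).

Section families.
Context {R : realType} {d : nat}.
Variables (a : set (euclidean R d) -> euclidean R d)
  (side : set (euclidean R d) -> R).
Implicit Types (C S : set (set (euclidean R d))).
Local Notation mu := (lebesgue_tuple R d).
Local Notation vol C := (mu (\bigcup_(Q in C) Q)).

Lemma cubes_measurable C Q : cubes a side C -> C Q -> measurable Q.
Proof. by move=> cC /cC[_ ->]; exact: measurable_cube. Qed.

Lemma cubes_bigcup_measurable C :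
  finite_set C -> cubes a side C -> measurable (\bigcup_(Q in C) Q).
Proof.
by move=> fC cC; apply: fin_bigcup_measurable => // Q; exact: cubes_measurable.
Qed.

Lemma cubes_sub C C' : C' `<=` C -> cubes a side C -> cubes a side C'.
Proof. by move=> CC cC Q /CC; exact: cC. Qed.

Lemma cubes_bounded C : finite_set C -> cubes a side C ->
  exists (b : euclidean R d) (l : R), 0 < l /\ \bigcup_(Q in C) Q `<=` cube b l.
Proof.
move=> fC cC.
pose r Q : R := \sum_k `|(tnth (a Q) k : R)| + `|side Q|.
pose B := \sum_(Q <- fset_set C) r Q.
have r0 Q : 0 <= r Q by rewrite addr_ge0// sumr_ge0.
have B0 : 0 <= B by rewrite sumr_ge0.
exists [tuple (- B : measurableTypeR R) | i < d], (B + B + 1).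
split; first by rewrite ltr_wpDl// addr_ge0.
move=> x [Q CQ Qx] k; rewrite tnth_mktuple.
have [Q0 QE] := cC _ CQ; move: Qx; rewrite QE => /(_ k).
have rB : r Q <= B.
  rewrite /B (big_fsetD1 Q)/=; last by rewrite in_fset_set// inE.
  by rewrite lerDl sumr_ge0.
have ar : `|(tnth (a Q) k : R)| + side Q <= r Q.
  rewrite lerD ?ler_norm// (bigD1 k)//= lerDl; exact: sumr_ge0.
have := ler_norm (tnth (a Q) k : R); have := ler_norm (- tnth (a Q) k : R).
rewrite normrN; lra.
Qed.

Lemma measure_cubes C Q : cubes a side C -> C Q -> mu Q = (side Q ^+ d)%:E.
Proof. by move=> cC /cC[Q0 QE]; rewrite [in LHS]QE lebesgue_tuple_cube. Qed.

(** Separated points of the union, each with a cube of C that contains it.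
    Separation 2 lam L exceeds the sum of any two sides, so these cubes are
    disjoint, and each has volume at least (L / lam)^d. *)
Lemma comparable_disjoint (lam L : R) C : 0 < lam -> 0 < L ->
  finite_set C -> cubes a side C ->
  (forall Q, C Q -> side Q <= L < lam * side Q) ->
  exists S, [/\ S `<=` C, trivIset S id &
    (vol C <= ((lam ^+ 2 *+ 2) ^+ d)%:E * vol S)%E].
Proof.
move=> lam0 L0 fC cC sL.
have [b [l [l0 Cbl]]] := cubes_bounded _ fC cC.
(* The factor lam makes s strictly larger than twice any side, which is what
   disjointness of closed cubes requires. *)
pose s := L * lam *+ 2.
have L2s Q : C Q -> side Q *+ 2 < s.
  move=> CQ; have /andP[QL LQ] := sL Q CQ; rewrite ltrMn2r/=; apply: (le_lt_trans QL).
  by rewrite [L * lam]mulrC (lt_le_trans LQ)// ler_pM2l.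
have s0 : 0 < s by rewrite pmulrn_lgt0// mulr_gt0.
have [P [PC sP muP]] :=
  measure_le_separated _ _ _ _ _ _ s0 l0 (cubes_bigcup_measurable _ fC cC) Cbl.
have /choice[F FP] : forall p, exists Q, p \in P -> C Q /\ Q p.
  move=> p; have [pP|] := boolP (p \in P).
    by have [Q CQ Qp] := PC _ pP; exists Q.
  by exists set0.
exists (F @` [set` P]).
have FC : F @` [set` P] `<=` C by move=> _ [p /FP[CFp _] <-].
have irr : irreflexive (@separated R d s).
  by move=> x; apply/existsP => -[k]; rewrite subrr normr0 leNgt s0.
have uP : uniq P by exact: pairwise_uniq irr sP.
have tP : trivIset [set` P] F.
  pose e x y := (x == y) || @separated R d s x y.
  have : pairwise e P by apply: sub_pairwise sP => x y; rewrite /e => ->; exact: orbT.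
  rewrite pairwise_all2rel; last 2 first.
  - by move=> x; rewrite /e eqxx.
  - move=> x y; rewrite /e eq_sym; congr (_ || _).
    by apply: eq_existsb => k; rewrite distrC.
  move=> /allrelP eP p q Pp Pq [z [pz qz]].
  have /orP[/eqP//|/existsP[k]] := eP p q Pp Pq.
  have [CFp Fpp] := FP _ Pp; have [CFq Fqq] := FP _ Pq.
  have [p0 pE] := cC _ CFp; have [q0 qE] := cC _ CFq.
  have := L2s _ CFp; have := L2s _ CFq.
  move: Fpp pz Fqq qz; rewrite pE qE => /(_ k) + /(_ k) + /(_ k) + /(_ k).
  (* A common point z puts p and q within the sum of the two sides, below s. *)
  rewrite -pE -qE ler_normr => *; exfalso; lra.
split => //; first exact: trivIset_image.
rewrite bigcup_image [X in (_ * X)%E]measure_fin_bigcup//; last first.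
  by move=> p /FP[CFp _]; exact: cubes_measurable cC CFp.
  exact: finite_seq.
rewrite -fsbig_seq//.
apply: (le_trans muP).
apply: (@le_trans _ _ (((lam ^+ 2 *+ 2) ^+ d)%:E *
    \sum_(p <- P) ((L / lam) ^+ d)%:E)%E).
  rewrite sumEFin -EFinM lee_fin big_const_seq count_predT iter_addr_0.
  rewrite mulrnAr -exprMn /s (_ : lam ^+ 2 *+ 2 * (L / lam) = L * lam *+ 2)//.
  by rewrite mulrnAl mulrCA expr2 mulfK ?gt_eqF.
apply: lee_wpmul2l; first by rewrite lee_fin exprn_ge0// mulrn_wge0// exprn_ge0// ltW.
rewrite big_seq [leRHS]big_seq; apply: lee_sum => p /FP[CFp _].
have [p0 _] := cC _ CFp.
rewrite [X in (_ <= X)%E](measure_cubes _ _ cC CFp) lee_fin lerXn2r ?nnegrE ?ltW//.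
  by rewrite divr_gt0.
by rewrite ltr_pdivrMr// mulrC; have /andP[] := sL _ CFp.
Qed.

(** Induction on the number of cubes.  The cubes comparable to a largest one are
    handled by [comparable_disjoint], at the cost of the first summand of the
    constant.  A cube meeting a selected one is at most half as large as it,
    and so is covered by its concentric double: this is the summand 2^d.  The
    rest is disjoint from the selected cubes and is left to the induction. *)
Lemma greedy_disjoint (lam : R) C : 1 < lam -> finite_set C -> cubes a side C ->
  (forall Q Q', C Q -> C Q' ->
    side Q < lam * side Q' \/ lam * side Q' *+ 2 <= side Q) ->
  exists S, [/\ S `<=` C, trivIset S id &
    (vol C <= ((lam ^+ 2 *+ 2) ^+ d + 2 ^+ d)%:E * vol S)%E].
Proof.
move=> lam1 fC; have [n] := ubnP #|` fset_set C|.
have lam0 : 0 < lam by exact: lt_trans lam1.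
elim: n C fC => // n IHn C fC; rewrite ltnS => Cn cC scales.
have [->|/set0P[Q1 CQ1]] := eqVneq C set0.
  exists set0; split => //.
  by rewrite bigcup_set0 measure0 mule0.
have [Q0 [CQ0 Q0max]] : exists Q0, C Q0 /\ forall Q, C Q -> side Q <= side Q0.
  have CQ1' : Q1 \in fset_set C by rewrite in_fset_set// inE.
  case: (@Order.TotalTheory.arg_maxP _ _ (fset_set C) [` CQ1']%fset xpredT
    (side \o val)) => // Q0 _ maxQ0.
  exists (val Q0); split.
    by have := valP Q0; rewrite in_fset_set// inE.
  move=> Q CQ; have CQ' : Q \in fset_set C by rewrite in_fset_set// inE.
  exact: (maxQ0 [` CQ']%fset).
have [s0 Q0E] := cC _ CQ0.
pose G := [set Q | C Q /\ side Q0 < lam * side Q].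
have GC : G `<=` C by move=> Q [].
have fG := sub_finite_set GC fC.
have cG := cubes_sub _ _ GC cC.
have [|S1 [S1G tS1 GS1]] := comparable_disjoint _ _ _ lam0 s0 fG cG.
  by move=> Q [CQ ->]; rewrite Q0max.
have S1C := subset_trans S1G GC.
have fS1 := sub_finite_set S1C fC; have cS1 := cubes_sub _ _ S1C cC.
pose C' := [set Q | [/\ C Q, ~ G Q & forall Q1, S1 Q1 -> Q `&` Q1 = set0]].
have C'C : C' `<=` C by move=> Q [].
have fC' := sub_finite_set C'C fC; have cC' := cubes_sub _ _ C'C cC.
have [||S' [S'C' tS' CS']] := IHn C' fC' _ cC'.
- rewrite (leq_trans _ Cn)// [ltnRHS](cardfsD1 Q0) in_fset_set// mem_set//.
  rewrite add1n ltnS -fset_setD1//; apply: fsubset_leq_card.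
  rewrite -fset_set_sub//; last exact: finite_setD.
  move=> Q [CQ nGQ _]; split => //= QQ0; apply: nGQ; rewrite QQ0; split => //.
  by rewrite ltr_pMl.
- by move=> Q Q' /C'C CQ /C'C; exact: scales.
have S'C := subset_trans S'C' C'C.
have fS' := sub_finite_set S'C fC; have cS' := cubes_sub _ _ S'C cC.
have S1S' Q Q' : S1 Q -> S' Q' -> Q `&` Q' = set0.
  by move=> SQ /S'C'[_ _ /(_ _ SQ)]; rewrite setIC.
(* The concentric double of Q. *)
pose D Q := cube [tuple ((tnth (a Q) k : R) - side Q / 2 : measurableTypeR R)
  | k < d] (side Q *+ 2).
have mD Q : measurable (D Q) by exact: measurable_cube.
have mUD : measurable (\bigcup_(Q in S1) D Q) by exact: fin_bigcup_measurable.
have CU : \bigcup_(Q in C) Q `<=`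
    \bigcup_(Q in G) Q `|` \bigcup_(Q in S1) D Q `|` \bigcup_(Q in C') Q.
  move=> x [Q CQ Qx]; have [GQ|nGQ] := pselect (G Q); first by left; left; exists Q.
  have [|] := pselect (exists2 Q1, S1 Q1 & Q `&` Q1 !=set0); last first.
    move=> noQ1; right; exists Q => //; split => // Q2 SQ2.
    by apply/eqP; apply: contra_notT noQ1 => /set0P; exists Q2.
  move=> [Q2 SQ2 [z [Qz Q2z]]]; left; right; exists Q2 => //.
  (* The dichotomy is relative to Q0, while Q2 may be smaller than Q0 by a
     factor lam: this is why the gap is 2 lam and not 2. *)
  have QQ2 : side Q *+ 2 <= side Q2.
    have [/(conj CQ)/nGQ//|Q2Q0] := scales Q0 Q CQ0 CQ.
    have [_ /(le_lt_trans Q2Q0)] := S1G _ SQ2.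
    by rewrite -mulrnAr ltr_pM2l// => /ltW.
  move=> k; rewrite tnth_mktuple.
  have [q0 QE] := cC _ CQ; have [q20 Q2E] := cC _ (S1C _ SQ2).
  move: Qx Qz Q2z; rewrite QE Q2E => /(_ k) + /(_ k) + /(_ k); rewrite -Q2E; lra.
have volD : (mu (\bigcup_(Q in S1) D Q) <= (2 ^+ d)%:E * vol S1)%E.
  apply: (@le_trans _ _ (\sum_(Q \in S1) mu (D Q))%E).
    exact: content_sub_fsum.
  rewrite measure_fin_bigcup//; last by move=> Q; exact: cubes_measurable cS1.
  rewrite ge0_mule_fsumr//; apply: lee_fsum => // Q SQ.
  have [q0 _] := cS1 _ SQ; rewrite [X in (_ <= _ * X)%E](measure_cubes _ _ cS1 SQ).
  rewrite lebesgue_tuple_cube ?mulrn_wgt0//.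
  by rewrite -EFinM -exprMn mulrC mulr_natr.
exists (S1 `|` S'); split.
- by rewrite subUset.
- move=> Q Q' [SQ|SQ] [SQ'|SQ'].
  + exact: tS1.
  + by rewrite S1S'// => -[].
  + by rewrite setIC S1S'// => -[].
  + exact: tS'.
rewrite bigcup_setU measureU; last 3 first.
- exact: cubes_bigcup_measurable.
- exact: cubes_bigcup_measurable.
- apply/seteqP; split => // x [[Q SQ Qx] [Q' SQ' Q'x]].
  by have := S1S' _ _ SQ SQ'; move/seteqP => [/(_ x) + _]; apply.
have mUC C1 : C1 `<=` C -> measurable (\bigcup_(Q in C1) Q).
  move=> C1C; apply: cubes_bigcup_measurable; last exact: cubes_sub cC.
  exact: sub_finite_set fC.
have mGD : measurable (\bigcup_(Q in G) Q `|` \bigcup_(Q in S1) D Q).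
  by apply: measurableU => //; exact: mUC.
rewrite ge0_muleDr//; apply: (@le_trans _ _ (mu (\bigcup_(Q in G) Q) +
    mu (\bigcup_(Q in S1) D Q) + vol C')%E).
  apply: (@le_trans _ _ (mu (\bigcup_(Q in G) Q `|`
      \bigcup_(Q in S1) D Q) + vol C')%E).
    apply: (@le_trans _ _ (mu (\bigcup_(Q in G) Q `|`
        \bigcup_(Q in S1) D Q `|` \bigcup_(Q in C') Q))).
      by apply: le_measure; rewrite ?inE//; do ?[exact: mUC|apply: measurableU].
    by apply: measureU2 => //; exact: mUC.
  by apply: leeD => //; apply: measureU2 => //; exact: mUC.
have A0 : 0 <= (lam ^+ 2 *+ 2) ^+ d.
  by rewrite exprn_ge0// mulrn_wge0// exprn_ge0// ltW.
by apply: leeD => //; rewrite EFinD ge0_muleDl ?lee_fin// ?exprn_ge0//; exact: leeD.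
Qed.
End families.

(** * Splitting a family by scales *)

(** Let k(x) = floor (log_lam x).  If k(x) <= k(y) then log_lam x exceeds
    log_lam y by less than 1.  Otherwise k(x) >= k(y) + n + 2, so that
    log_lam x exceeds log_lam y by more than n + 1, that is x > lam^(n+1) y,
    and lam^n >= 2. *)
Lemma scale_dichotomy (R : realType) (lam x y : R) (n : nat) :
  1 < lam -> 2 <= lam ^+ n -> 0 < x -> 0 < y ->
  (Num.floor (ln x / ln lam) = Num.floor (ln y / ln lam) %[mod n.+2])%Z ->
  x < lam * y \/ lam * y *+ 2 <= x.
Proof.
move=> lam1 lamn x0 y0 xy; have lam0 : 0 < lam by exact: lt_trans lam1.
have ll0 : 0 < ln lam by rewrite ln_gt0.
set kx := Num.floor (ln x / ln lam) in xy *; set ky := Num.floor _ in xy *.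
have xlt : ln x < (kx + 1)%:~R * ln lam by rewrite -ltr_pdivrMr// floorD1_gt.
have ley : ky%:~R * ln lam <= ln y by rewrite -ler_pdivlMr// floor_le.
have ylt : ln y < (ky + 1)%:~R * ln lam by rewrite -ltr_pdivrMr// floorD1_gt.
have lex : kx%:~R * ln lam <= ln x by rewrite -ler_pdivlMr// floor_le.
have [kxy|kxy] := leP kx ky.
  left; rewrite -ltr_ln ?posrE ?mulr_gt0// lnM ?posrE//.
  apply: (lt_le_trans xlt); rewrite intrD mulrDl mul1r addrC lerD2l.
  by apply: le_trans ley; rewrite ler_pM2r// ler_int.
right; have kxy' : ky + n.+2%:Z <= kx.
  move/eqP: xy; rewrite eqz_mod_dvd => /dvdzP[q qE].
  have q0 : 0 < q by rewrite -(pmulr_lgt0 _ (_ : 0 < n.+2%:Z))// -qE subr_gt0.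
  rewrite addrC -lerBrDr qE; nia.
have : ln (y * lam ^+ n.+1) <= ln x.
  rewrite lnM ?posrE ?exprn_gt0// lnXn//; apply: le_trans lex.
  apply: (@le_trans _ _ ((ky + n.+2%:Z)%:~R * ln lam)); last first.
    by rewrite ler_pM2r// ler_int.
  rewrite (_ : _%:~R = (ky + 1)%:~R + n.+1%:R); last first.
    by rewrite !intrD -addrA -[n.+2]add1n PoszD intrD.
  by rewrite mulrDl lerD ?(ltW ylt)// mulr_natl.
rewrite ler_ln ?posrE ?mulr_gt0 ?exprn_gt0//; apply: le_trans.
by rewrite exprS mulrA [lam * y]mulrC -mulr_natr ler_pM2l// mulr_gt0.
Qed.

Lemma bernoulli_le (R : numDomainType) (x : R) n :
  0 <= x -> 1 + x *+ n <= (1 + x) ^+ n.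
Proof.
move=> x0; elim: n => [|n IHn]; first by rewrite mulr0n addr0 expr0.
rewrite exprSr mulrDr mulr1 mulrS [x + _]addrC addrA lerD//.
by rewrite ler_peMl// (le_trans _ IHn)// lerDl mulrn_wge0.
Qed.

Lemma exists_large_part d (T : measurableType d) (R : realType)
    (m : {measure set T -> \bar R}) (n : nat) (U : set T) (V : nat -> set T) :
  measurable U -> (forall r, measurable (V r)) ->
  U `<=` \bigcup_(r < n.+1) V r ->
  exists r, (m U <= n.+1%:R%:E * m (V r))%E.
Proof.
move=> mU mV UV.
case: (@Order.TotalTheory.arg_maxP _ _ 'I_n.+1 ord0 xpredT
  (fun i => m (V i))) => // r _ rmax.
exists r; apply: (@le_trans _ _ (\sum_(i < n.+1) m (V i))%E).
  by apply: content_subadditive => //; rewrite -bigcup_mkord.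
apply: (@le_trans _ _ (\sum_(i < n.+1) m (V r))%E).
  by apply: lee_sum => i _; exact: rmax.
by rewrite sumr_const card_ord mule_natl.
Qed.

(** * The bound *)

(** With lam = 1 + 1/d, the greedy selection costs at most (e^2 + 1) 2^d, and
    the restriction to one of d + 2 classes of scales at most 2d. *)
Lemma disjoint_fraction_cubes (R : realType) (d : nat) : (2 <= d)%N ->
  disjoint_fraction d (((expR 2 + 1) *+ 2)^-1 * (2 ^- d / d%:R) : R).
Proof.
move=> d2; have d0 : 0 < d%:R :> R by rewrite ltr0n ltnW.
move=> C fC cC.
pose lam : R := 1 + d%:R^-1.
have lam1 : 1 < lam by rewrite ltrDl invr_gt0.
have lamd : 2 <= lam ^+ d.
  have := @bernoulli_le R d%:R^-1 d (ltW _); rewrite invr_gt0 => /(_ d0).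
  by rewrite -[_^-1 *+ _]mulr_natr mulVf ?gt_eqF// -(natrD _ 1 1).
have lamA : (lam ^+ 2 *+ 2) ^+ d + 2 ^+ d <= (expR 2 + 1) * 2 ^+ d.
  rewrite mulrDl mul1r lerD2r -mulr_natr exprMn ler_pM2r ?exprn_gt0//.
  rewrite -exprM.
  apply: (@le_trans _ _ (expR d%:R^-1 ^+ (2 * d))).
    by rewrite lerXn2r ?nnegrE ?expR_ge0 ?expR_ge1Dx// ltW// (lt_trans _ lam1).
  by rewrite -expRM_natl natrM mulfK ?gt_eqF.
have /choice[a' cC'] : forall Q, exists p : euclidean R d * R,
    C Q -> 0 < p.2 /\ Q = cube p.1 p.2.
  move=> Q; have [/cC[b [l Ql]]|nCQ] := pselect (C Q); first by exists (b, l).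
  by exists ([tuple 0 | i < d], 0).
pose a Q := (a' Q).1; pose side Q := (a' Q).2.
have cCa : cubes a side C by move=> Q /cC'.
pose kappa Q := Num.floor (ln (side Q) / ln lam).
pose Cr (r : nat) := [set Q | C Q /\ (kappa Q = r %[mod d.+2])%Z].
have CrC r : Cr r `<=` C by move=> Q [].
have [||r Ur] := exists_large_part _ _ _ (lebesgue_tuple R d) d.+1
    (\bigcup_(Q in C) Q) (fun r => \bigcup_(Q in Cr r) Q)
    (cubes_bigcup_measurable _ _ _ fC cCa).
- move=> r; apply: cubes_bigcup_measurable; last exact: cubes_sub (CrC r) cCa.
  exact: sub_finite_set fC.
- move=> x [Q CQ Qx].
  have kr : (`|(kappa Q %% d.+2)%Z| < d.+2)%N by lia.
  exists `|(kappa Q %% d.+2)%Z|%N => //; exists Q => //; split => //=.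
  by rewrite gez0_abs ?modz_mod// modz_ge0.
have [|S [SCr tS volS]] := greedy_disjoint _ _ _ _ lam1
    (sub_finite_set (CrC r) fC) (cubes_sub _ _ _ _ (CrC r) cCa).
  move=> Q Q' [CQ kQ] [CQ' kQ']; apply: scale_dichotomy lamd _ _ _ => //.
  - by have [] := cCa _ CQ.
  - by have [] := cCa _ CQ'.
  - by rewrite -/(kappa Q) -/(kappa Q') kQ kQ'.
exists S; split => //; first exact: subset_trans SCr _.
set Z := (lebesgue_tuple R d (\bigcup_(Q in S) Q)) in volS *.
set c : R := _ * (_ / _).
have c0 : 0 <= c.
  by rewrite mulr_ge0// ?invr_ge0 ?mulrn_wge0 ?addr_ge0 ?expR_ge0// mulr_ge0
    ?invr_ge0 ?exprn_ge0.
have Z0 : (0 <= Z)%E by exact: measure_ge0.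
apply: (@le_trans _ _ (c%:E * (d.+2%:R%:E *
    (((lam ^+ 2 *+ 2) ^+ d + 2 ^+ d)%:E * Z)))%E).
  apply: lee_wpmul2l; first by rewrite lee_fin.
  apply: (le_trans Ur); apply: lee_wpmul2l => //; by rewrite lee_fin.
rewrite !muleA -!EFinM -[leRHS]mul1e; apply: lee_wpmul2r => //.
rewrite lee_fin.
apply: (@le_trans _ _ (c * (d%:R *+ 2) * ((expR 2 + 1) * 2 ^+ d))).
  apply: ler_pM => //.
  - by rewrite mulr_ge0.
  - by rewrite addr_ge0// exprn_ge0// mulrn_wge0// exprn_ge0// ltW//
      (lt_trans _ lam1).
  apply: ler_wpM2l => //; rewrite -mulrnA ler_nat; lia.
have e0 : (expR 2 + 1 : R) != 0 by rewrite gt_eqF// addr_gt0 ?expR_gt0.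
have p0 : (2 ^+ d : R) != 0 by rewrite expf_neq0// pnatr_eq0.
have d0' : (d%:R : R) != 0 by rewrite gt_eqF.
rewrite /c le_eqVlt; apply/orP; left; apply/eqP.
field; rewrite ?e0 ?d0' ?p0//.
Qed.

Lemma disjoint_fraction_le (R : realType) (d : nat) (g h : R) :
  h <= g -> disjoint_fraction d g -> disjoint_fraction d h.
Proof.
move=> hg gd C fC cC; have [S [SC tS gS]] := gd C fC cC.
exists S; split => //; apply: le_trans gS.
by apply: lee_wpmul2r; [exact: measure_ge0|rewrite lee_fin].
Qed.

Lemma ln_le_sub1 (R : realType) (x : R) : 0 < x -> ln x <= x - 1.
Proof.
by move=> x0; rewrite lerBrDl -[leRHS]lnK ?posrE// expR_ge1Dx.
Qed.

(** After taking logarithms, ln z <= z - 1 is used twice: at z = 1 / x, to absorb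
    - ln x / x into the term b^-1 / x, and at z = 1 / (c x), to bound the
    remaining c^-1 / x from below by 1 - ln (c x). *)
Lemma correction_le (R : realType) (c b x : R) : 0 < c -> 0 < b -> b <= x ->
  expR (- 1 - ln x / x - (c^-1 + b^-1) / x) <= c * x.
Proof.
move=> c0 b0 bx; have x0 : 0 < x by exact: lt_le_trans bx.
rewrite -[leRHS]lnK ?posrE ?mulr_gt0// ler_expR lnM ?posrE//.
have lnx : - ln x <= b^-1.
  rewrite -lnV ?posrE//; apply: (le_trans (ln_le_sub1 _ _ _)).
    by rewrite invr_gt0.
  by rewrite lerBlDr (@le_trans _ _ b^-1) ?lerDl// lef_pV2 ?posrE.
have lncx : - (ln c + ln x) <= c^-1 / x - 1.
  rewrite -lnM ?posrE// -lnV ?posrE ?mulr_gt0// -invfM.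
  by apply: ln_le_sub1; rewrite invr_gt0 mulr_gt0.
have : - ln x / x <= b^-1 / x by rewrite ler_pM2r ?invr_gt0.
rewrite mulNr mulrDl; lra.
Qed.

Theorem theorem1p3 (R : realType) :
  (exists2 c : R, 0 < c &
    forall d : nat, (2 <= d)%N ->
      c * (2 ^- d / (d%:R * ln d%:R)) <= Gamma R d /\
      (forall C : set (set (euclidean R d)),
        finite_set C -> (forall Q, C Q -> is_cube Q) ->
        exists S : set (set (euclidean R d)),
          [/\ S `<=` C, trivIset S id &
              ((c * (2 ^- d / (d%:R * ln d%:R)))%:E
                 * lebesgue_tuple R d (\bigcup_(Q in C) Q)
               <= lebesgue_tuple R d (\bigcup_(Q in S) Q))%E])) /\
  (exists2 K : R, 0 < K &
    forall d : nat, (2 <= d)%N ->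
      expR (- 1 - ln (ln d%:R) / ln d%:R - K / ln d%:R)
        * (2 ^- d / (d%:R * ln d%:R)) <= Gamma R d).
Proof.
pose c0 : R := ((expR 2 + 1) *+ 2)^-1.
have c0_gt0 : 0 < c0 by rewrite invr_gt0 mulrn_wgt0// addr_gt0 ?expR_gt0.
have ln2_gt0 : 0 < ln 2 :> R by rewrite ln_gt0// ltr1n.
have lnd (d : nat) : (2 <= d)%N -> ln 2 <= ln d%:R :> R.
  by move=> d2; rewrite ler_ln ?posrE ?ltr0n ?ler_nat// ltnW.
have dilute (d : nat) (k : R) : (2 <= d)%N -> k <= c0 * ln d%:R ->
    disjoint_fraction d (k * (2 ^- d / (d%:R * ln d%:R))).
  move=> d2 kc; have l0 := lt_le_trans ln2_gt0 (lnd _ d2).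
  have d0 : 0 < d%:R :> R by rewrite ltr0n ltnW.
  apply: disjoint_fraction_le (disjoint_fraction_cubes R d d2).
  rewrite invfM (_ : k * _ = k / ln d%:R * (2 ^- d / d%:R)); last by ring.
  apply: ler_wpM2r; first by rewrite mulr_ge0 ?invr_ge0 ?exprn_ge0 ?ltW.
  by rewrite ler_pdivrMr.
split.
  exists (c0 * ln 2) => [|d d2]; first exact: mulr_gt0.
  have dfc : disjoint_fraction d (c0 * ln 2 * (2 ^- d / (d%:R * ln d%:R))).
    by apply: dilute => //; rewrite ler_pM2l// lnd.
  by split; [exact: le_Gamma|exact: dfc].
exists (c0^-1 + (ln 2)^-1) => [|d d2]; first by rewrite addr_gt0 ?invr_gt0.
by apply/le_Gamma/dilute => //; apply: correction_le => //; exact: lnd.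
Qed.
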